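(* In the continuous-time single-buyer game with known total value $V$, there exists a mechanism for the seller which obtains total revenue $V/e$ from every buyer type (the buyer having a dominant strategy under which it pays $V/e$).
   Context: Continuous-time single-buyer game: a single buyer has a Lipschitz-continuous value function $v:[0,1]\to[0,\infty)$ with $\int_0^1 v(t)\,dt=V$, where $V$ is known to the seller but $v$ is not. At each time the seller allocates a fraction $r(t)\in[0,1]$ of the (infinitesimal) item and the buyer pays at rate $x(t)\ge 0$; the buyer is limited-liability: $x(t)\le r(t)v(t)$ at all times. The buyer's utility is $\int_0^1(r(t)v(t)-x(t))\,dt$ and the seller's revenue is $\int_0^1 x(t)\,dt$. A dominant strategy for the buyer is one maximizing its utility. *)

(* Defs.v *)
From HB Require Import structures.
From mathcomp Require Import all_boot all_order all_algebra.
From mathcomp Require Import all_classical all_reals all_analysis.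
Set Implicit Arguments. Unset Strict Implicit. Unset Printing Implicit Defensive.
Import Order.TTheory GRing.Theory Num.Theory.
Import numFieldNormedType.Exports.
Local Open Scope classical_set_scope.
Local Open Scope ring_scope.

Section Game.
Variable R : realType.

Definition leb := (@lebesgue_measure R).

(* A (payment-history-dependent) mechanism: given the buyer's payment-rate
   function x and a time t, it returns the allocation rate r(t) = M x t. *)
Definition mechanism := (R -> R) -> R -> R.

Definition nonanticipative (M : mechanism) : Prop :=
  forall (x y : R -> R) (t : R), 0 <= t <= 1 ->
    (forall s, 0 <= s < t -> x s = y s) -> M x t = M y t.

Definition valid_mechanism (M : mechanism) : Prop :=
  nonanticipative M /\
  (forall (x : R -> R) (t : R), 0 <= t <= 1 -> 0 <= M x t <= 1).

Definition buyer_type (V : R) (v : R -> R) : Prop :=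
  (exists L : R, forall s t, 0 <= s <= 1 -> 0 <= t <= 1 ->
       `|v s - v t| <= L * `|s - t|) /\
  (forall t, 0 <= t <= 1 -> 0 <= v t) /\
  Rintegral leb `[0, 1] v = V.

(* Feasible buyer strategy (payment rate x) against mechanism M, with
   limited liability 0 <= x(t) <= r(t) v(t). *)
Definition feasible (M : mechanism) (v : R -> R) (x : R -> R) : Prop :=
  leb.-integrable `[0, 1] (EFin \o x) /\
  leb.-integrable `[0, 1] (EFin \o (fun t => M x t * v t)) /\
  (forall t, 0 <= t <= 1 -> 0 <= x t <= M x t * v t).

Definition utility (M : mechanism) (v : R -> R) (x : R -> R) : R :=
  Rintegral leb `[0, 1] (fun t => M x t * v t - x t).

Definition revenue (x : R -> R) : R := Rintegral leb `[0, 1] x.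

Definition dominant (M : mechanism) (v : R -> R) (x : R -> R) : Prop :=
  feasible M v x /\
  forall y, feasible M v y -> utility M v y <= utility M v x.

End Game.

(* Main.v *)
(** Let c = e/V and let X(t) be the amount paid before time t. The seller
    allocates r(t) = exp(min(c X(t), 1) - 1).

    Upper bound: paying y(t) under rate r(t) amounts to reporting the value
    y(t)/r(t) <= v(t). Since r is nondecreasing, the utility of y is at most
    r(1) (V - int y/r), and the chain rule gives
    int y/r >= V (1 - exp(-min(c X(1), 1))), so that this bound is V/e.

    Attainment: with W(t) = int_0^t v, the buyer pays everything, x = r v, until
    W = V (1 - 1/e), and nothing afterwards. Then X = (V/e) ln(V/(V - W)) and
    r = V/(e (V - W)) up to that time, where X reaches V/e and r reaches 1; the
    utility is the remaining value V/e.

    Payments are merely integrable, so X is only absolutely continuous. The chain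
    rule is therefore proved by cutting [0, b] into n pieces on which W grows by
    the same amount: the error on each piece is quadratic in that amount. *)
Require Import Defs.
From HB Require Import structures.
From mathcomp Require Import all_boot all_order all_algebra.
From mathcomp Require Import all_classical all_reals all_analysis.
From mathcomp Require Import measurable_realfun ring lra.
Import Order.TTheory GRing.Theory Num.Theory.
Import numFieldNormedType.Exports.
Local Open Scope classical_set_scope.
Local Open Scope ring_scope.

(** With [n] cuts at equal increments of [W], the increments of [Phi] add up to at most
    [K * W b ^+ 2 / n], which is arbitrarily small. The cuts come from the continuity of [W]; [Phi]
    itself may be discontinuous. *)
Lemma le_of_quadratic_increments (R : realType) (b K : R) (W Phi : R -> R) :
  0 <= K -> W 0 = 0 -> (forall t, 0 <= t <= b -> 0 <= W t) ->
  {within `[0, b], continuous W} ->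
  (forall s t, 0 <= s -> s <= t -> t <= b ->
     Phi t - Phi s <= K * (W t - W s) ^+ 2) ->
  0 <= b -> Phi b <= Phi 0.
Proof.
move=> K0 W0 Wge0 cW incr b0.
have step d : 0 <= d -> forall n t, 0 <= t <= b -> W t <= n%:R * d ->
    Phi t - Phi 0 <= n%:R * (K * d ^+ 2).
  move=> d0; elim=> [|n IHn] t /andP[t0 tb] Wt.
    have Wt0 : W t = 0.
      by apply/eqP; rewrite eq_le Wge0 ?t0 ?tb// andbT; move: Wt; rewrite mul0r.
    by have := incr 0 t (lexx _) t0 tb; rewrite Wt0 W0 subrr expr0n/= mulr0 mul0r.
  have Kd0 : 0 <= K * d ^+ 2 by rewrite mulr_ge0// sqr_ge0.
  have [Wtn|Wtn] := leP (W t) (n%:R * d).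
    have := IHn t; rewrite t0 tb => /(_ isT Wtn).
    by rewrite -natr1 mulrDl mul1r => ?; lra.
  (* The last cut: at [s] the value [n * d] is reached, so the induction hypothesis covers [[0, s]]
     and [W] grows by at most [d] from [s] to [t]. *)
  have [||s sI Ws] := @IVT _ W 0 t (n%:R * d) t0.
  - apply: continuous_subspaceW cW => x /=; rewrite !in_itv/= => /andP[-> xt].
    exact: le_trans xt tb.
  - rewrite W0 ge_min le_max (ltW Wtn) orbT andbT.
    by rewrite mulr_ge0 ?ler0n.
  move: sI; rewrite in_itv/= => /andP[s0 st].
  have := IHn s; rewrite s0 (le_trans st tb) Ws => /(_ isT (lexx _)) Hs.
  have Ht := incr s t s0 st tb.
  have : K * (W t - W s) ^+ 2 <= K * d ^+ 2.
    rewrite ler_wpM2l// Ws.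
    move: Wt; rewrite -natr1 mulrDl mul1r => Wt.
    by rewrite ler_sqr ?nnegrE; lra.
  by rewrite -natr1 mulrDl mul1r => ?; lra.
rewrite leNgt; apply/negP => lt0b.
have D0 : 0 < Phi b - Phi 0 by rewrite subr_gt0.
have Wb0 : 0 <= W b by rewrite Wge0 ?lexx ?b0.
(* Enough pieces for the total error to fall below the supposed excess [Phi b - Phi 0]. *)
set n := (Num.truncn (K * W b ^+ 2 / (Phi b - Phi 0))).+1.
have nlt : K * W b ^+ 2 / (Phi b - Phi 0) < n%:R.
  exact: truncnS_gt.
have n0 : (0 : R) < n%:R by rewrite ltr0n.
have Wbn0 : 0 <= W b / n%:R by rewrite divr_ge0// ltW.
have b0b : 0 <= b <= b by rewrite b0 lexx.
have := step _ Wbn0 n b b0b.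
rewrite [n%:R * _]mulrC divfK ?gt_eqF// => /(_ (lexx _)).
rewrite leNgt => /negP; apply.
have -> : n%:R * (K * (W b / n%:R) ^+ 2) = K * W b ^+ 2 / n%:R.
  by field; rewrite gt_eqF.
by rewrite ltr_pdivrMr// [ltRHS]mulrC -ltr_pdivrMr.
Qed.

(** * Integrability of real-valued combinations *)

Section RealIntegrable.
#[local] Set Implicit Arguments.
#[local] Unset Strict Implicit.
Context d {T : measurableType d} {R : realType} {mu : {measure set T -> \bar R}}.
Implicit Types (c : R) (w f h : T -> R).

Lemma integrable_realZl (D : set T) c w : measurable D ->
  mu.-integrable D (EFin \o w) -> mu.-integrable D (EFin \o (fun u => c * w u)).
Proof.
move=> mD iw.
by apply: (eq_integrable mD _ _ _ (integrableZl mD c iw)) => //.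
Qed.

Lemma integrable_realD (D : set T) w f : measurable D ->
  mu.-integrable D (EFin \o w) -> mu.-integrable D (EFin \o f) ->
  mu.-integrable D (EFin \o (fun u => w u + f u)).
Proof.
move=> mD iw ig.
by apply: (eq_integrable mD _ _ _ (integrableD mD iw ig)) => //.
Qed.

Lemma integrable_realB (D : set T) w f : measurable D ->
  mu.-integrable D (EFin \o w) -> mu.-integrable D (EFin \o f) ->
  mu.-integrable D (EFin \o (fun u => w u - f u)).
Proof.
move=> mD iw ig.
by apply: (eq_integrable mD _ _ _ (integrableB mD iw ig)) => //.
Qed.

Lemma integrable_realMl (D : set T) h w (M : R) : measurable D ->
  measurable_fun D h -> (forall u, D u -> `|h u| <= M) ->
  mu.-integrable D (EFin \o w) -> mu.-integrable D (EFin \o (fun u => h u * w u)).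
Proof.
move=> mD mh hM iw.
apply: (eq_integrable mD _ _ _ (integrableMr mD mh _ iw)) => //.
exists M; split; first exact: num_real.
by move=> x Mx u Du; apply: le_trans (hM _ Du) (ltW Mx).
Qed.

End RealIntegrable.

(** * Indefinite integrals and a one-sided chain rule *)

Section IndefiniteIntegral.
#[local] Set Implicit Arguments.
#[local] Unset Strict Implicit.
Context {R : realType}.
Local Notation mu := (@lebesgue_measure R).
Implicit Types (b s t K : R) (w f F : R -> R).

Lemma integrable_subitv w b (i : interval R) :
  mu.-integrable `[0, b] (EFin \o w) -> (i <= `[0, b])%O ->
  mu.-integrable [set` i] (EFin \o w).
Proof.
move=> iw ib; apply: integrableS iw => //.
by move=> x /=; exact: (subitvP ib).
Qed.

Lemma indefinite_integralB w b s t : mu.-integrable `[0, b] (EFin \o w) ->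
  0 <= s -> s <= t -> t <= b ->
  \int[mu]_(u in `[0, t]) w u - \int[mu]_(u in `[0, s]) w u =
  \int[mu]_(u in `]s, t]) w u.
Proof.
move=> iw s0 st tb; apply: Rintegral_itvB; rewrite ?bnd_simp//.
by apply: integrable_subitv iw _; rewrite subitvE !bnd_simp.
Qed.

Lemma le_indefinite_integral w b s t : mu.-integrable `[0, b] (EFin \o w) ->
  (forall u, 0 <= u <= b -> 0 <= w u) -> 0 <= s -> s <= t -> t <= b ->
  \int[mu]_(u in `[0, s]) w u <= \int[mu]_(u in `[0, t]) w u.
Proof.
move=> iw w0 s0 st tb; rewrite -subr_ge0 (indefinite_integralB iw)//.
apply: Rintegral_ge0 => u /=; rewrite in_itv/= => /andP[su ut].
by apply: w0; rewrite (le_trans ut tb) (le_trans s0 (ltW su)).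
Qed.

(* m stands for the slope of F on [p, q]; an inequality suffices here, and equality
   follows by applying the lemma to both F and -F. *)
Lemma chain_rule_le b K w f F : 0 <= b -> 0 <= K ->
  let W t := \int[mu]_(u in `[0, t]) w u in
  mu.-integrable `[0, b] (EFin \o w) ->
  (forall t, 0 <= t <= b -> 0 <= w t) ->
  mu.-integrable `[0, b] (EFin \o (fun t => f (W t) * w t)) ->
  (forall p q, 0 <= p -> p <= q -> q <= W b ->
     exists2 m, F q - F p <= m * (q - p) &
                forall z, p <= z <= q -> m <= f z + K * (q - p)) ->
  F (W b) - F 0 <= \int[mu]_(t in `[0, b]) (f (W t) * w t).
Proof.
move=> b0 K0 W iw w0 ifw slope.
have W0 : W 0 = 0 by rewrite /W set_itv1 Rintegral_set1.
have Wle s t : 0 <= s -> s <= t -> t <= b -> W s <= W t.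
  exact: (le_indefinite_integral iw w0).
(* The excess of the left side over the right side when both stop at [t], up to the constant
   [F 0]. *)
pose Phi t := F (W t) - \int[mu]_(u in `[0, t]) (f (W u) * w u).
suff : Phi b <= Phi 0.
  by rewrite /Phi W0 set_itv1 Rintegral_set1; lra.
apply: (@le_of_quadratic_increments _ b K W) => //.
- by move=> t /andP[t0 tb]; rewrite -W0 Wle.
- exact: parameterized_integral_continuous.
move=> s t s0 st tb.
have [||| m Fm mf] := slope (W s) (W t).
- by rewrite -W0 Wle// (le_trans st).
- exact: Wle.
- by rewrite Wle// (le_trans s0).
have sub : (`]s, t] <= `[0%R, b])%O by rewrite subitvE !bnd_simp/= s0 tb.
have iwst := integrable_subitv iw sub.
have ifwst := integrable_subitv ifw sub.
have IW : W t - W s = \int[mu]_(u in `]s, t]) w u.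
  exact: indefinite_integralB iw _ _ _.
have IfW := indefinite_integralB ifw s0 st tb.
(* The bound on [m], taken at [z = W u] and integrated against [w u]: its error term becomes
   [K * (W t - W s) ^+ 2]. *)
have : m * (W t - W s) <=
    \int[mu]_(u in `]s, t]) (f (W u) * w u) + K * (W t - W s) * (W t - W s).
  rewrite [X in X <= _](_ : _ = \int[mu]_(u in `]s, t]) (m * w u)); last first.
    by rewrite RintegralZl// IW.
  rewrite [X in _ + _ * X]IW -RintegralZl//.
  have izw c : mu.-integrable `]s, t] (EFin \o (fun u => c * w u)).
    exact: integrable_realZl.
  rewrite -RintegralD//.
  apply: le_Rintegral => //; first exact: integrable_realD.
  move=> u /=; rewrite in_itv/= => /andP[su ut].
  have u0 : 0 <= u by rewrite (le_trans s0)// ltW.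
  rewrite -mulrDl ler_wpM2r ?w0 ?u0 ?(le_trans ut)// mf//.
  by rewrite !Wle// ?(ltW su)// (le_trans ut).
by rewrite /Phi; lra.
Qed.

End IndefiniteIntegral.

(** * Tangent-line bounds for exp and ln *)

Section ExpLnEstimates.
Context {R : realType}.
Implicit Types x y : R.

Lemma expR_subr_le x y : expR y - expR x <= expR y * (y - x).
Proof.
have : expR y * (1 + (x - y)) <= expR y * expR (x - y).
  by rewrite ler_wpM2l ?expR_ge0// expR_ge1Dx.
have -> : x - y = - (y - x) by ring.
rewrite -expRD (_ : y - (y - x) = x); last by ring.
by rewrite mulrDr mulr1 mulrN; lra.
Qed.

Lemma ln_subr_le x y : 0 < x -> 0 < y -> ln x - ln y <= (x - y) / y.
Proof.
move=> x0 y0; rewrite -ln_div//.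
have -> : x / y = 1 + (x - y) / y by field; rewrite gt_eqF.
apply: le_ln1Dx; rewrite -subr_gt0 opprK.
have -> : (x - y) / y + 1 = x / y by field; rewrite gt_eqF.
by rewrite divr_gt0.
Qed.

End ExpLnEstimates.

(** * Total payment at the rate [a / (V - W)] *)

Section Mechanism.
#[local] Set Implicit Arguments.
#[local] Unset Strict Implicit.
Context {R : realType}.
Local Notation mu := (@lebesgue_measure R).
Implicit Types (b s t V : R) (v w x y : R -> R).

Lemma measurable_indefinite_integral w b : 0 <= b ->
  mu.-integrable `[0, b] (EFin \o w) ->
  measurable_fun `[0, b] (fun t => \int[mu]_(u in `[0, t]) w u).
Proof.
move=> b0 iw; apply: subspace_continuous_measurable_fun => //.
exact: parameterized_integral_continuous.
Qed.

(** The function [- a * ln (V - z)] is an antiderivative of [a / (V - z)]. Since [W b <= V - a], the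
    denominator stays at least [a], so the rate is at most 1 and is Lipschitz in [W] with constant
    [a^-1]. *)
Lemma integral_reciprocal_rate a V b w : 0 < a -> 0 <= b ->
  let W t := \int[mu]_(u in `[0, t]) w u in
  mu.-integrable `[0, b] (EFin \o w) ->
  (forall t, 0 <= t <= b -> 0 <= w t) -> W b <= V - a ->
  mu.-integrable `[0, b] (EFin \o (fun t => a / (V - W t) * w t)) /\
  \int[mu]_(t in `[0, b]) (a / (V - W t) * w t) = a * (ln V - ln (V - W b)).
Proof.
move=> a0 b0 W iw w0 WbV.
have Wb t : 0 <= t <= b -> W t <= V - a.
  move=> /andP[t0 tb]; apply: le_trans WbV.
  exact: (le_indefinite_integral iw w0).
have iaw : mu.-integrable `[0, b] (EFin \o (fun t => a / (V - W t) * w t)).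
  have mW : measurable_fun `[0, b] W by exact: measurable_indefinite_integral.
  apply: (@integrable_realMl _ _ _ _ _ _ _ 1) => //; last first.
    move=> t /=; rewrite in_itv/= => /Wb Wt.
    have VW : 0 < V - W t by lra.
    by rewrite ger0_norm ?divr_ge0 ?(ltW a0) ?(ltW VW)// ler_pdivrMr//; lra.
  (* As [V - W t] is positive, its inverse is [expR (- ln (V - W t))], a composition of measurable
     functions. *)
  apply: (@eq_measurable_fun _ _ _ _ _ (fun t => a * expR (- ln (V - W t)))).
    move=> t; rewrite inE/= in_itv/= => /Wb Wt.
    by rewrite expRN lnK// posrE; lra.
  apply: measurable_funM => //; apply: measurableT_comp => //.
  apply: measurableT_comp => //; apply: measurableT_comp => //.
  exact: measurable_funB.
split=> //.
have a_neq0 : a != 0 by rewrite gt_eqF.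
have ainv0 : 0 <= a^-1 by rewrite invr_ge0 ltW.
have rate_increment p q : p <= q -> q <= V - a ->
    a / (V - q) - a / (V - p) <= a^-1 * (q - p).
  move=> pq qV.
  have Vq : 0 < V - q by lra.
  have Vp : 0 < V - p by lra.
  have -> : a / (V - q) - a / (V - p) = a * (q - p) / ((V - q) * (V - p)).
    by field; rewrite !gt_eqF.
  rewrite ler_pdivrMr ?mulr_gt0//.
  have -> : a * (q - p) = a^-1 * (q - p) * (a * a) by field.
  by apply: ler_wpM2l; [rewrite mulr_ge0// subr_ge0|apply: ler_pM; lra].
have log_increment p q : p < V -> q < V ->
    a * (ln (V - p) - ln (V - q)) <= a / (V - q) * (q - p).
  move=> pV qV; rewrite -mulrA ler_wpM2l ?(ltW a0)//.
  apply: le_trans (ln_subr_le _ _ _ _) _; rewrite ?subr_gt0//.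
  by rewrite mulrC (_ : V - p - (V - q) = q - p)//; ring.
have W0 : W 0 = 0 by rewrite /W set_itv1 Rintegral_set1.
apply/le_anti/andP; split.
- have negE : (fun t => - (a / (V - W t)) * w t) =
      (fun t => -1 * (a / (V - W t) * w t)).
    by apply/funext => t; rewrite mulN1r mulNr.
  have := @chain_rule_le _ b a^-1 w (fun z => - (a / (V - z)))
    (fun z => a * ln (V - z)) b0 ainv0 iw w0.
  rewrite -/W negE RintegralZl// mulN1r subr0 => chain.
  suff : a * ln (V - W b) - a * ln V <=
    - \int[mu]_(t in `[0, b]) (a / (V - W t) * w t) by rewrite mulrBr; lra.
  apply: chain; first exact: integrable_realZl.
  (* [a * ln (V - z)] is concave, so its slope at the left end bounds the increment. *)
  move=> p q p0 pq qW; exists (- (a / (V - p))).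
    have qVa : q <= V - a by exact: le_trans WbV.
    rewrite -mulrBr (_ : _ * (q - p) = a / (V - p) * (p - q)); last by ring.
    by apply: log_increment; lra.
  move=> z /andP[pz zq].
  have := rate_increment p z pz (le_trans zq (le_trans qW WbV)).
  have : a^-1 * (z - p) <= a^-1 * (q - p) by rewrite ler_wpM2l// lerD2r.
  lra.
- have := @chain_rule_le _ b a^-1 w (fun z => a / (V - z))
    (fun z => - (a * ln (V - z))) b0 ainv0 iw w0 iaw.
  rewrite -/(W b) subr0 opprK mulrBr addrC; apply.
  (* The opposite function is convex, so the slope is taken at the right end. *)
  move=> p q p0 pq qW; exists (a / (V - q)).
    have qVa : q <= V - a by exact: le_trans WbV.
    by rewrite opprK addrC -mulrBr; apply: log_increment; lra.
  move=> z /andP[pz zq].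
  have := rate_increment z q zq (le_trans qW WbV).
  have : a^-1 * (q - z) <= a^-1 * (q - p) by rewrite ler_wpM2l// lerD2l lerN2.
  lra.
Qed.

(** * The mechanism and its allocation rate *)

Definition allocation (c p : R) : R := expR (Num.min (c * p) 1 - 1).

(** The interval is open at [t] so that the rate depends on strictly earlier payments only, as
    [nonanticipative] demands. *)
Definition payment_mechanism (c : R) : mechanism R :=
  fun x t => allocation c (\int[mu]_(u in `[0, t[) x u).

Lemma allocation_le1 c p : allocation c p <= 1.
Proof. by rewrite -expR0 ler_expR subr_le0 ge_min lexx orbT. Qed.

Lemma le_allocation c p q : 0 <= c -> p <= q -> allocation c p <= allocation c q.
Proof. by move=> c0 pq; rewrite ler_expR lerD2r le_min2// ler_wpM2l. Qed.

Lemma allocationV c p : (allocation c p)^-1 = expR (1 - Num.min (c * p) 1).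
Proof. by rewrite -expRN opprB. Qed.

Lemma payment_mechanism_valid c : valid_mechanism (payment_mechanism c).
Proof.
split=> [x y t _ xy | x t _]; last by rewrite expR_ge0 allocation_le1.
rewrite /payment_mechanism; congr allocation; apply: eq_Rintegral => u.
by rewrite inE/= in_itv/=; exact: xy.
Qed.

Lemma payment_mechanismE c b x t : mu.-integrable `[0, b] (EFin \o x) -> t <= b ->
  payment_mechanism c x t = allocation c (\int[mu]_(u in `[0, t]) x u).
Proof.
move=> ix tb; rewrite /payment_mechanism Rintegral_itv_bndo_bndc//.
by apply: integrable_subitv ix _; rewrite subitvE !bnd_simp.
Qed.

Lemma measurable_capped_integral c b x : 0 <= b ->
  mu.-integrable `[0, b] (EFin \o x) ->
  measurable_fun `[0, b]
    (fun t => Num.min (c * (\int[mu]_(u in `[0, t]) x u)) 1).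
Proof.
move=> b0 ix; apply: measurable_minr => //; apply: measurable_funM => //.
exact: measurable_indefinite_integral.
Qed.

Lemma measurable_allocation c b x : 0 <= b ->
  mu.-integrable `[0, b] (EFin \o x) ->
  measurable_fun `[0, b] (fun t => allocation c (\int[mu]_(u in `[0, t]) x u)).
Proof.
move=> b0 ix; rewrite /allocation; apply: measurableT_comp => //.
by apply: measurable_funB => //; exact: measurable_capped_integral.
Qed.

Lemma measurable_allocationV c b x : 0 <= b ->
  mu.-integrable `[0, b] (EFin \o x) ->
  measurable_fun `[0, b] (fun t => (allocation c (\int[mu]_(u in `[0, t]) x u))^-1).
Proof.
move=> b0 ix.
rewrite [X in measurable_fun _ X](_ : _ = fun t =>
    expR (1 - Num.min (c * \int[mu]_(u in `[0, t]) x u) 1)); last first.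
  by apply/funext => t; rewrite allocationV.
apply: measurableT_comp => //.
by apply: measurable_funB => //; exact: measurable_capped_integral.
Qed.

(** The inverse rate is [expR (1 - min (c z, 1))], whose exponent is at most 1 and [c]-Lipschitz for
    nonnegative payments; hence the constant [expR 1 * c]. This is the slope condition of
    [chain_rule_le]. *)
Lemma allocation_slope c p z q : 0 < c -> 0 <= p -> p <= z -> z <= q ->
  (allocation c p)^-1 <= (allocation c z)^-1 + expR 1 * c * (q - p).
Proof.
move=> c0 p0 pz zq; rewrite !allocationV.
set P := Num.min (c * p) 1; set Z := Num.min (c * z) 1.
have := expR_subr_le (1 - Z) (1 - P).
rewrite (_ : 1 - P - (1 - Z) = Z - P); last by ring.
move=> H; rewrite -lerBlDl (le_trans H)//.
have ZP : Z - P <= c * (q - p).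
  rewrite /Z /P; have : c * z <= c * q by rewrite ler_pM2l.
  have : c * p <= c * z by rewrite ler_pM2l.
  by rewrite mulrBr; case: (leP (c * z) 1); case: (leP (c * p) 1); lra.
have PZ : 0 <= Z - P by rewrite subr_ge0 le_min2// ler_pM2l.
rewrite -mulrA; apply: ler_pM; rewrite ?expR_ge0//.
by rewrite ler_expR lerBlDr lerDl le_min mulr_ge0// ltW.
Qed.

(** Below the cap, [V * c = expR 1] makes [- V * expR (- c z)] an antiderivative of the inverse
    rate. Above it the potential is constant while the inverse rate is 1, so only an inequality
    survives. *)
Lemma allocation_potential V c p q : 0 < V -> V * c = expR 1 -> p <= q ->
  V * expR (- Num.min (c * p) 1) - V * expR (- Num.min (c * q) 1)
    <= (allocation c p)^-1 * (q - p).
Proof.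
move=> V0 Vc pq; rewrite allocationV.
have c0 : 0 < c by rewrite -(pmulr_rgt0 _ V0) Vc expR_gt0.
set P := Num.min (c * p) 1; set Q := Num.min (c * q) 1.
have := expR_subr_le (- Q) (- P).
rewrite opprK [- P + Q]addrC => /(ler_wpM2l (ltW V0)).
rewrite mulrBr => /le_trans; apply.
have -> : expR (1 - P) * (q - p) = V * (expR (- P) * (c * (q - p))).
  by rewrite expRD -Vc; ring.
apply: ler_wpM2l; first exact: ltW.
apply: ler_wpM2l; first exact: expR_ge0.
have : c * p <= c * q by rewrite ler_pM2l.
by rewrite /Q /P mulrBr; case: (leP (c * p) 1); case: (leP (c * q) 1); lra.
Qed.

(** * Upper bound on the utility *)

Lemma utility_le V v y : 0 < V -> mu.-integrable `[0, 1] (EFin \o v) ->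
  \int[mu]_(t in `[0, 1]) v t = V ->
  let M := payment_mechanism (expR 1 / V) in
  feasible M v y -> utility M v y <= V / expR 1.
Proof.
move=> V0 iv intv M; rewrite /feasible /utility /leb => -[iy [iMv yle]].
set c := expR 1 / V.
have c0 : 0 < c by rewrite divr_gt0// expR_gt0.
pose Y t := \int[mu]_(u in `[0, t]) y u.
have y0 t : 0 <= t <= 1 -> 0 <= y t by move=> /yle/andP[].
have Yle s t : 0 <= s -> s <= t -> t <= 1 -> Y s <= Y t.
  exact: (le_indefinite_integral iy y0).
have Y0 : Y 0 = 0 by rewrite /Y set_itv1 Rintegral_set1.
have ME t : 0 <= t <= 1 -> M y t = allocation c (Y t).
  by move=> /andP[_ t1]; rewrite /M (payment_mechanismE _ iy).
(* [f (Y t) * y t] is the value that the buyer reports at time [t] by paying [y t]. *)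
pose f p := (allocation c p)^-1.
have ify : mu.-integrable `[0, 1] (EFin \o (fun t => f (Y t) * y t)).
  apply: (@integrable_realMl _ _ _ _ _ _ _ (expR 1)) => //.
    exact: measurable_allocationV.
  move=> t /=; rewrite in_itv/= => /andP[t0 t1].
  rewrite /f allocationV ger0_norm ?expR_ge0// ler_expR lerBlDr lerDl.
  by rewrite le_min ler01 andbT mulr_ge0 ?(ltW c0)// -Y0 Yle.
have chain : V - V * expR (- Num.min (c * Y 1) 1) <=
    \int[mu]_(t in `[0, 1]) (f (Y t) * y t).
  have := @chain_rule_le _ 1 (expR 1 * c) y f
    (fun p => - (V * expR (- Num.min (c * p) 1))) ler01 _ iy y0 ify.
  rewrite mulr0 (min_idPl ler01) oppr0 expR0 mulr1 opprK addrC; apply.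
    by rewrite mulr_ge0 ?expR_ge0// ltW.
  move=> p q p0 pq _; exists (f p).
    by rewrite opprK addrC; apply: allocation_potential => //;
      rewrite /c mulrC divfK// gt_eqF.
  by move=> z /andP[pz zq]; exact: allocation_slope.
have ifvy : mu.-integrable `[0, 1] (EFin \o (fun t => v t - f (Y t) * y t)).
  exact: integrable_realB.
pose r1 := allocation c (Y 1).
(* The rate at [t] is at most the final rate [r1], and it multiplies the unreported value, which
   limited liability makes nonnegative. *)
apply: (@le_trans _ _ (\int[mu]_(t in `[0, 1]) (r1 * (v t - f (Y t) * y t)))).
  apply: le_Rintegral => //; first exact: integrable_realB.
    exact: integrable_realZl.
  move=> t /=; rewrite in_itv/= => t01.
  have /andP[t0 t1] := t01.
  have rt0 : 0 < allocation c (Y t) by rewrite expR_gt0.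
  have := yle _ t01; rewrite ME// => /andP[_ yrv].
  have -> : allocation c (Y t) * v t - y t =
      allocation c (Y t) * (v t - f (Y t) * y t).
    by rewrite mulrBr mulrA /f mulfV ?mul1r// gt_eqF.
  apply: ler_wpM2r; last by rewrite le_allocation ?(ltW c0)// Yle.
  by rewrite subr_ge0 /f ler_pdivrMl.
rewrite RintegralZl// RintegralB// intv.
apply: (@le_trans _ _ (r1 * (V * expR (- Num.min (c * Y 1) 1)))).
  by rewrite ler_wpM2l ?expR_ge0//; lra.
(* The two exponents sum to -1 whatever the total payment [Y 1] is. *)
rewrite /r1 /allocation mulrCA -expRD.
by rewrite (_ : _ - 1 + _ = -1) ?expRN//; ring.
Qed.

(** * An optimal strategy that pays [V / expR 1] *)

Lemma full_payment_strategy V v : 0 < V ->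
  mu.-integrable `[0, 1] (EFin \o v) -> (forall t, 0 <= t <= 1 -> 0 <= v t) ->
  \int[mu]_(t in `[0, 1]) v t = V ->
  let M := payment_mechanism (expR 1 / V) in
  exists x, [/\ feasible M v x, utility M v x = V / expR 1 &
                revenue x = V / expR 1].
Proof.
move=> V0 iv v0 intv M; set c := expR 1 / V.
have e0 : 0 < expR 1 :> R by exact: expR_gt0.
pose a := V / expR 1.
have a0 : 0 < a by rewrite divr_gt0.
have ca : c * a = 1 by rewrite /c /a; field; rewrite !gt_eqF.
have aV : a <= V.
  by rewrite /a ler_pdivrMr// ler_peMr ?(ltW V0)// ltW// expR_gt1.
pose W t := \int[mu]_(u in `[0, t]) v u.
have Wle s t : 0 <= s -> s <= t -> t <= 1 -> W s <= W t.
  exact: (le_indefinite_integral iv v0).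
have W0 : W 0 = 0 by rewrite /W set_itv1 Rintegral_set1.
(* [tau] is a time at which the remaining value is exactly [a]; there the rate reaches 1. *)
have [||tau tau01 Wtau] := @IVT _ W 0 1 (V - a) ler01.
- exact: parameterized_integral_continuous.
- by rewrite W0 /W intv ge_min le_max subr_ge0 aV gerBl (ltW a0) orbT.
move: tau01; rewrite in_itv/= => /andP[tau0 tau1].
pose g t := a / (V - W t) * v t.
have VW t : 0 <= t <= tau -> a <= V - W t.
  by move=> /andP[t0 ttau]; have := Wle _ _ t0 ttau tau1; lra.
have rate t : 0 <= t <= tau -> mu.-integrable `[0, t] (EFin \o g) /\
    \int[mu]_(u in `[0, t]) g u = a * (ln V - ln (V - W t)).
  move=> /andP[t0 ttau].
  have t1 := le_trans ttau tau1.
  apply: (@integral_reciprocal_rate a V t v) => //.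
  - by apply: integrable_subitv iv _; rewrite subitvE !bnd_simp.
  - by move=> s /andP[s0 st]; rewrite v0// s0 (le_trans st).
  - by have := VW t; rewrite t0 ttau => /(_ isT); rewrite /W; lra.
(* The equation [x = M x * v] is circular, since the rate depends on the payments. So [x] is given
   by its explicit solution, and [Min] checks afterwards that the mechanism answers with the rate
   [a / (V - W t)]. *)
pose x := g \_ `[0, tau].
have xin t : 0 <= t <= tau -> x t = g t.
  by move=> t01; rewrite /x patchE mem_set//= in_itv/=.
have xout t : tau < t -> x t = 0.
  by move=> tt; rewrite /x patchE memNset//= in_itv/= => /andP[_]; rewrite leNgt tt.
have tau_in : 0 <= tau <= tau by rewrite tau0 lexx.
have sub01 : `[0, tau] `<=` `[0, 1 : R].
  by move=> t /=; rewrite !in_itv/= => /andP[-> /le_trans]; apply.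
have ix : mu.-integrable `[0, 1] (EFin \o x).
  rewrite -restrict_EFin; apply/integrable_restrict => //.
  by rewrite setIidr//; exact: (rate _ tau_in).1.
have Xin t : 0 <= t <= tau ->
    \int[mu]_(u in `[0, t]) x u = a * (ln V - ln (V - W t)).
  move=> ttau; rewrite -(rate _ ttau).2; apply: eq_Rintegral => u.
  rewrite inE/= in_itv/= => /andP[u0 ut]; apply: xin; rewrite u0.
  by case/andP: ttau => _; exact: le_trans.
have lna : ln V - ln a = 1.
  by rewrite /a ln_div ?posrE// expRK opprB addrC subrK.
have Xout t : tau <= t -> \int[mu]_(u in `[0, t]) x u = a.
  move=> taut; rewrite /x -Rintegral_mkcondr setIidr.
    by rewrite (rate _ tau_in).2 Wtau subKr lna mulr1.
  by move=> u /=; rewrite !in_itv/= => /andP[-> /le_trans]; apply.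
have ME t : t <= 1 -> M x t = allocation c (\int[mu]_(u in `[0, t]) x u).
  by move=> t1; rewrite /M (payment_mechanismE _ ix).
have Min t : 0 <= t <= tau -> M x t = a / (V - W t).
  move=> tt; have VWt := VW _ tt; have VWt0 := lt_le_trans a0 VWt.
  rewrite ME; last by case/andP: tt => _ /le_trans; apply.
  rewrite Xin// /allocation mulrA ca mul1r.
  (* The cap in [allocation] is not exceeded up to [tau]. *)
  have L1 : ln V - ln (V - W t) <= 1.
    by rewrite -lna lerD2l lerN2 ler_ln ?posrE.
  rewrite (min_idPl L1) !expRB !lnK ?posrE// /a.
  by field; rewrite !gt_eqF.
have Mout t : tau <= t -> t <= 1 -> M x t = 1.
  by move=> tt t1; rewrite ME// Xout// /allocation ca minxx subrr expR0.
have Mv01 : mu.-integrable `[0, 1] (EFin \o (fun t => M x t * v t)).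
  apply: (@integrable_realMl _ _ _ _ _ _ _ 1) => //.
    apply: (@eq_measurable_fun _ _ _ _ _
      (fun t => allocation c (\int[mu]_(u in `[0, t]) x u))).
      by move=> t; rewrite inE/= in_itv/= => /andP[_ t1]; rewrite ME.
    exact: measurable_allocation.
  move=> t _; rewrite /M /payment_mechanism ger0_norm ?expR_ge0//.
  exact: allocation_le1.
exists x; split.
- split=> //; split=> // t /andP[t0 t1].
  have [ttau|taut] := leP t tau.
    have tt : 0 <= t <= tau by rewrite t0.
    rewrite Min// xin// lexx andbT mulr_ge0 ?v0 ?t0//.
    by rewrite divr_ge0 ?(ltW a0)// (le_trans (ltW a0))// VW.
  by rewrite xout// Mout ?(ltW taut)// mul1r lexx v0// t0.
(* The utility rate is 0 up to [tau] and [v] afterwards, so the utility is [V - W tau = a]. *)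
- have -> : utility M v x =
      \int[mu]_(t in `[0, 1]) (v t - (v \_ `[0, tau]) t).
    apply: eq_Rintegral => t; rewrite inE/= in_itv/= => /andP[t0 t1].
    have [ttau|taut] := leP t tau.
      have tt : 0 <= t <= tau by rewrite t0.
      by rewrite Min// xin// patchE mem_set ?subrr//= in_itv/=.
    rewrite xout// Mout ?(ltW taut)// mul1r patchE memNset//= in_itv/= => /andP[_].
    by rewrite leNgt taut.
  rewrite RintegralB//; last first.
    rewrite -restrict_EFin; apply/integrable_restrict => //.
    by rewrite setIidr//; apply: integrableS iv.
  by rewrite -Rintegral_mkcondr setIidr// intv -/(W tau) Wtau subKr.
- exact: Xout.
Qed.

(** * Integrability of buyer types, and the theorem *)

Lemma lipschitz_integrable L v :
  (forall s t, 0 <= s <= 1 -> 0 <= t <= 1 -> `|v s - v t| <= L * `|s - t|) ->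
  mu.-integrable `[0, 1] (EFin \o v).
Proof.
move=> lip; apply: continuous_compact_integrable; first exact: segment_compact.
apply/subspace_continuousP => x x01; apply/cvgrPdist_le => e e0.
(* The sign of [L] is not given; [|L| + 1] is a positive Lipschitz constant. *)
rewrite near_withinE; have L0 : 0 < `|L| + 1 by rewrite ltr_wpDl.
exists (e / (`|L| + 1)) => /=; first by rewrite divr_gt0.
move=> t /= xt t01; rewrite (le_trans (lip _ _ _ _))//.
move: (ltW xt); rewrite ler_pdivlMr// mulrC; apply: le_trans.
by rewrite ler_wpM2r// (le_trans (ler_norm _))// lerDl.
Qed.

End Mechanism.

Theorem theorem6 (R : realType) (V : R) :
  exists M : mechanism R,
    valid_mechanism M /\
    forall v : R -> R, buyer_type V v ->
      exists x : R -> R, dominant M v x /\ revenue x = V / expR 1.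
Proof.
have [V0|V0] := ltP 0 V.
  exists (payment_mechanism (expR 1 / V)); split.
    exact: payment_mechanism_valid.
  move=> v [[L lip] [v0 intv]].
  have iv := lipschitz_integrable lip.
  have [x [fx ux rx]] := full_payment_strategy V0 iv v0 intv.
  exists x; split=> //; split=> // y fy.
  by rewrite ux; exact: utility_le.
(* For [V <= 0], buyer types exist only if [V = 0]. Allocating nothing then forces every payment to
   be 0, which is [V / expR 1]. *)
exists (fun _ _ => 0); split.
  by split=> // x t _; rewrite lexx ler01.
move=> v [_ [v0 intv]].
have V_eq0 : V = 0.
  apply/le_anti; rewrite V0 -intv; apply: Rintegral_ge0 => t /=.
  by rewrite in_itv/=; exact: v0.
exists (fun=> 0); split; last first.
  by rewrite V_eq0 mul0r /revenue Rintegral_cst// mul0r.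
split=> [|y [_ [_ y0]]].
  have i0 : (@leb R).-integrable `[0, 1] (EFin \o (fun=> 0 : R)).
    exact: integrable0.
  split=> //; split=> [|t _]; last by rewrite mul0r lexx.
  by apply: eq_integrable i0 => // t _; rewrite /= mul0r.
rewrite le_eqVlt; apply/orP; left; apply/eqP; apply: eq_Rintegral => t.
rewrite inE/= in_itv/= => /y0; rewrite !mul0r => /le_anti <-.
by [].
Qed.
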